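(* Let $G$ be a Lie group and let $\mathfrak g_2=\mathfrak g$ act on $TT^*G\simeq(G\circledS\mathfrak g_1^* )\circledS(\mathfrak g_2\circledS\mathfrak g_3^* )$, with the Tulczyjew symplectic form, by $((g,\mu,\xi,\nu);\eta)\mapsto(g,\mu,\xi+\eta,\nu)$. The Poisson reduction of $TT^*G$ under this action of $\mathfrak g_2$ results in $(G\circledS\mathfrak g_1^* )\circledS\mathfrak g_3^*$ endowed with the bracket $$\{E,F\}(g,\mu,\nu)=\Big\langle T_e^*R_g\frac{\delta E}{\delta g},\frac{\delta F}{\delta\nu}\Big\rangle-\Big\langle T_e^*R_g\frac{\delta F}{\delta g},\frac{\delta E}{\delta\nu}\Big\rangle+\Big\langle\nu,\Big[\frac{\delta E}{\delta\nu},\frac{\delta F}{\delta\nu}\Big]\Big\rangle .$$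
   Context: $G$ is a (finite-dimensional) Lie group with identity $e$, $\mathfrak g=T_eG$; $\mathfrak g_i,\mathfrak g_i^*$ are copies of $\mathfrak g,\mathfrak g^*$. $R_g$ is right multiplication, $T_e^*R_g:T_g^*G\to\mathfrak g^*$ the dual of $T_eR_g$; $\mathrm{Ad}_g=T_e(h\mapsto ghg^{-1})$, $[\xi,\eta]=\frac{d}{dt}|_{t=0}\mathrm{Ad}_{\exp t\xi}\eta$, $\langle\mathrm{ad}^*_\xi\mu,\eta\rangle=-\langle\mu,[\xi,\eta]\rangle$. $T^*G$ is identified with $G\circledS\mathfrak g^*$ by $\alpha_g\mapsto(g,T_e^*R_g\alpha_g)$. $TT^*G=T(G\circledS\mathfrak g^* )$ is identified with $G\times\mathfrak g_1^*\times\mathfrak g_2\times\mathfrak g_3^*$ by sending $(V_g,V_\mu)$ at $(g,\mu)$ to $(g,\mu,\xi,\nu)$, $\xi=T_gR_{g^{-1}}V_g$, $\nu=V_\mu-\mathrm{ad}^*_\xi\mu$. The Tulczyjew form $\Omega_{TT^*G}$ is the tangent (complete) lift of the canonical form $d\theta$ of $T^*G$ ($\theta$ the Liouville form), transported by this map: on vectors $(T_eR_ga,\delta\mu,\delta\xi,\delta\nu)$, $(T_eR_g\bar a,\delta\bar\mu,\delta\bar\xi,\delta\bar\nu)$ at $(g,\mu,\xi,\nu)$ it equals $\langle\delta\nu,\bar a\rangle-\langle\delta\bar\nu,a\rangle+\langle\nu,[a,\bar a]\rangle+\langle\delta\mu,\delta\bar\xi\rangle-\langle\delta\bar\mu,\delta\xi\rangle$.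 Hamiltonian vector fields satisfy $i_{X_E}\Omega=-dE$; the Poisson bracket is $\{E,F\}=dE(X_F)$; the reduced bracket is its restriction to invariant functions, i.e. $E=E(g,\mu,\nu)$, $F=F(g,\mu,\nu)$. $\frac{\delta E}{\delta g}\in T_g^*G$, $\frac{\delta E}{\delta\nu}\in\mathfrak g$ are partial derivatives. *)

(* Defs.v *)
From HB Require Import structures.
From mathcomp Require Import all_boot all_order all_algebra.
From mathcomp Require Import all_classical all_reals all_analysis.
Set Implicit Arguments.
Unset Strict Implicit.
Unset Printing Implicit Defensive.
Import Order.TTheory GRing.Theory Num.Theory.
Import numFieldNormedType.Exports.
Local Open Scope classical_set_scope.
Local Open Scope ring_scope.

Section Smoothness.
Context {R : realType}.

(* C^k on an open set U; this is the usual notion as long as V is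
   finite-dimensional, which is the only case used below. *)
Fixpoint Ck {V W : normedModType R} (k : nat) (U : set V) (f : V -> W) : Prop :=
  if k is k'.+1 then
    (forall x, U x -> differentiable f x) /\
    (forall v, Ck k' U (fun x => 'D_v f x))
  else forall x, U x -> {for x, continuous f}.

Definition smooth_on {V W : normedModType R} (U : set V) (f : V -> W) : Prop :=
  forall k, Ck k U f.

(* An atlas on T, modelled on V, indexed by the points of T: [chart p] is a
   chart around p, with domain [cdom p]; [chart p] and its inverse [ichart p]
   are total functions whose values outside [cdom p], resp. outside
   [chart p @` cdom p], are irrelevant.  The tangent space at p is V, read in
   the chart [chart p]. *)
Record atlas (T : topologicalType) (V : normedModType R) := Atlas {
  cdom : T -> set T;
  chart : T -> T -> V;
  ichart : T -> V -> T }.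

Record smooth_atlas (T : topologicalType) (V : normedModType R)
    (A : atlas T V) : Prop := SmoothAtlas {
  cdom_open : forall p, open (cdom A p);
  cdom_center : forall p, cdom A p p;
  codom_open : forall p, open (chart A p @` cdom A p);
  chartK : forall p x, cdom A p x -> ichart A p (chart A p x) = x;
  chart_continuous : forall p x, cdom A p x -> {for x, continuous (chart A p)};
  ichart_continuous : forall p v,
    (chart A p @` cdom A p) v -> {for v, continuous (ichart A p)};
  transition_smooth : forall p q,
    smooth_on (chart A p @` (cdom A p `&` cdom A q))
              (fun v => chart A q (ichart A p v)) }.

Definition vatlas (V : normedModType R) : atlas V V :=
  Atlas (fun=> setT) (fun=> id) (fun=> id).

Definition prod_atlas (T T' : topologicalType) (V V' : normedModType R)
    (A : atlas T V) (A' : atlas T' V') : atlas (T * T')%type (V * V')%type :=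
  Atlas (fun p => cdom A p.1 `*` cdom A' p.2)
        (fun p x => (chart A p.1 x.1, chart A' p.2 x.2))
        (fun p v => (ichart A p.1 v.1, ichart A' p.2 v.2)).

Definition smooth_map (T T' : topologicalType) (V V' : normedModType R)
    (A : atlas T V) (A' : atlas T' V') (f : T -> T') : Prop :=
  continuous f /\
  forall p q, smooth_on (chart A p @` (cdom A p `&` f @^-1` cdom A' q))
                        (fun v => chart A' q (f (ichart A p v))).

Definition tangent (T T' : topologicalType) (V V' : normedModType R)
    (A : atlas T V) (A' : atlas T' V') (f : T -> T') (x : T) : V -> V' :=
  'd (fun v => chart A' (f x) (f (ichart A x v))) (chart A x x).

Definition smooth_fun (T : topologicalType) (V : normedModType R)
    (A : atlas T V) (f : T -> R^o) : Prop := smooth_map A (vatlas R^o) f.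

Definition differential (T : topologicalType) (V : normedModType R)
    (A : atlas T V) (f : T -> R^o) (x : T) : V -> R :=
  tangent A (vatlas R^o) f x.

(* The Poisson reduction of (T, brT) under the right action [act] of the additive
   group Gam results in (S, brS): Gam acts smoothly by Poisson maps, S is the
   orbit space, with projection [pr], its smooth functions are the smooth
   invariant functions on T, and brS is the restriction of brT to these. *)
Record poisson_reduction (T S : topologicalType) (V W : normedModType R)
    (A : atlas T V) (B : atlas S W) (Gam : normedModType R)
    (act : T -> Gam -> T) (brT : (T -> R^o) -> (T -> R^o) -> T -> R^o)
    (pr : T -> S) (brS : (S -> R^o) -> (S -> R^o) -> S -> R^o) : Prop :=
  PoissonReduction {
  act_zero : forall z, act z 0 = z;
  act_add : forall z a b, act z (a + b) = act (act z a) b;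
  act_smooth : smooth_map (prod_atlas A (vatlas Gam)) A (fun p => act p.1 p.2);
  act_poisson : forall a (E F : T -> R^o), smooth_fun A E -> smooth_fun A F ->
    forall z, brT (fun y => E (act y a)) (fun y => F (act y a)) z
              = brT E F (act z a);
  pr_surjective : forall s, exists z, pr z = s;
  pr_orbit : forall z z', pr z = pr z' <-> exists a, z' = act z a;
  pr_smooth : smooth_map A B pr;
  pr_quotient : forall E : S -> R^o,
    smooth_fun B E <-> smooth_fun A (fun z => E (pr z));
  pr_bracket : forall E F : S -> R^o, smooth_fun B E -> smooth_fun B F ->
    forall z, brT (fun y => E (pr y)) (fun y => F (pr y)) z = brS E F (pr z) }.

End Smoothness.

HB.structure Definition TopologicalGroupCarrier := {G of Group G & Topological G}.
Notation groupTopType := TopologicalGroupCarrier.type.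

Record lie_group {R : realType} {n : nat} (G : groupTopType)
    (A : atlas G 'rV[R]_n) : Prop := LieGroup {
  lie_hausdorff : hausdorff_space G;
  lie_second_countable : @second_countable G;
  lie_atlas : smooth_atlas A;
  lie_mul_smooth : smooth_map (prod_atlas A A) A (fun p : G * G => (p.1 * p.2)%g);
  lie_inv_smooth : smooth_map A A (fun g : G => (g^-1)%g) }.

Section LieGroup.
Context {R : realType} {n : nat} {G : groupTopType}.
Variable A : atlas G 'rV[R]_n.

(* The Lie algebra g = T_eG is 'rV[R]_n and its dual g^* is 'cV[R]_n. *)
Local Notation lie := ('rV[R]_n).
Local Notation dual := ('cV[R]_n).

Definition pairing (mu : dual) (xi : lie) : R := (xi *m mu) 0 0.

(* The elements of g^* and of g that represent a functional on g, resp. g^*. *)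
Definition covector (l : lie -> R) : dual := \col_i l (delta_mx 0 i).
Definition bidual_vector (l : dual -> R) : lie := \row_i l (delta_mx i 0).

Definition TR (g : G) : lie -> lie := tangent A A (fun h : G => (h * g)%g) 1%g.
Definition TRinv (g : G) : lie -> lie := tangent A A (fun h : G => (h * g^-1)%g) g.
Definition TRdual (g : G) (alpha : lie -> R) : dual :=
  covector (fun a => alpha (TR g a)).

Definition Ad (g : G) : lie -> lie :=
  tangent A A (fun h : G => (g * h * g^-1)%g) 1%g.

(* For every xi, t |-> e (t xi) is the one-parameter subgroup with velocity xi. *)
Definition exponential_map (e : lie -> G) : Prop := forall xi : lie,
  [/\ smooth_map (vatlas R^o) A (fun t : R^o => e (t *: xi)),
      forall s t : R, e ((s + t) *: xi) = (e (s *: xi) * e (t *: xi))%g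
    & tangent (vatlas R^o) A (fun t : R^o => e (t *: xi)) 0 1 = xi].

(* The exponential map exists and is unique on every Lie group, so the default
   value given to [xget] is never used. *)
Definition lie_exp : lie -> G :=
  xget (fun xi => ichart A 1%g (chart A 1%g 1%g + xi))
       [set e | exponential_map e].

Definition bracket (xi eta : lie) : lie :=
  derive1 (fun t : R => Ad (lie_exp (t *: xi)) eta) 0.

(* TT^*G, trivialized as G x g_1^* x g_2 x g_3^*. *)
Local Notation TTG := (G * dual * lie * dual)%type.
Local Notation TTG_model := (lie * dual * lie * dual)%type.

Definition TTG_atlas : atlas TTG TTG_model :=
  prod_atlas (prod_atlas (prod_atlas A (vatlas dual)) (vatlas lie)) (vatlas dual).

(* The complete lift of the canonical symplectic form of T^*G, expressed in the
   trivialization; the component along G of a tangent vector is written T_eR_g a,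
   i.e. a = T_gR_{g^-1} of that component. *)
Definition tulczyjew_form (z : TTG) (v w : TTG_model) : R :=
  let: (g, _, _, nu) := z in
  let: (vg, dmu, dxi, dnu) := v in
  let: (wg, dmu', dxi', dnu') := w in
  let a := TRinv g vg in
  let a' := TRinv g wg in
  pairing dnu a' - pairing dnu' a + pairing nu (bracket a a')
  + pairing dmu dxi' - pairing dmu' dxi.

(* i_{X_E} Omega = - dE; the form is nondegenerate, so exactly one v qualifies. *)
Definition hamiltonian_vector (E : TTG -> R^o) (z : TTG) : TTG_model :=
  xget 0 [set v | forall w,
    tulczyjew_form z v w = - differential TTG_atlas E z w].

Definition poisson_bracket (E F : TTG -> R^o) (z : TTG) : R^o :=
  differential TTG_atlas E z (hamiltonian_vector F z).

Definition translation (z : TTG) (eta : lie) : TTG :=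
  let: (g, mu, xi, nu) := z in (g, mu, xi + eta, nu).

Local Notation Red := (G * dual * dual)%type.

Definition reduced_atlas : atlas Red (lie * dual * dual)%type :=
  prod_atlas (prod_atlas A (vatlas dual)) (vatlas dual).

Definition reduction_map (z : TTG) : Red :=
  let: (g, mu, _, nu) := z in (g, mu, nu).

Definition partial_g (E : Red -> R^o) (g : G) (mu nu : dual) : lie -> R :=
  differential A (fun h => E (h, mu, nu)) g.

Definition partial_nu (E : Red -> R^o) (g : G) (mu nu : dual) : lie :=
  bidual_vector (differential (vatlas dual) (fun k => E (g, mu, k)) nu).

Definition reduced_bracket (E F : Red -> R^o) (s : Red) : R^o :=
  let: (g, mu, nu) := s in
  pairing (TRdual g (partial_g E g mu nu)) (partial_nu F g mu nu)
  - pairing (TRdual g (partial_g F g mu nu)) (partial_nu E g mu nu)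
  + pairing nu (bracket (partial_nu E g mu nu) (partial_nu F g mu nu)).

End LieGroup.

(* Main.v *)
Require Import Defs.
From HB Require Import structures.
From mathcomp Require Import all_boot all_order all_algebra.
From mathcomp Require Import all_classical all_reals all_analysis.
From mathcomp Require Import ring.
Set Implicit Arguments.
Unset Strict Implicit.
Unset Printing Implicit Defensive.
Import Order.TTheory GRing.Theory Num.Theory.
Import numFieldNormedType.Exports.
Local Open Scope classical_set_scope.
Local Open Scope ring_scope.

(** Write [m] for the multiplication of [G] read in the chart at [1], and [x0] for
    the image of [1].  Since [Ad_a] is right translation by [a^-1] composed with left
    translation by [a], differentiating [Ad_(exp (t xi)) eta] at [t = 0] gives
    [[xi, eta] = D_(xi,0) D_(0,eta) m - D_(eta,0) D_(0,xi) m] at [(x0, x0)], by the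
    symmetry of second derivatives; hence the bracket is bilinear and antisymmetric,
    and the Tulczyjew form is alternating.

    For an invariant function [E(g, mu, nu)] the equation [i_X Omega = - dE] is solved
    by [X = (T_eR_g b, 0, dE/dmu, kappa)] with [b = dE/dnu] and
    [kappa = - T_e^*R_g dE/dg - <nu, [b, _]>].  If [X_F] is the Hamiltonian vector of
    [F] and [X] is this one for [E], then
    [dE(X_F) = - Omega(X, X_F) = Omega(X_F, X) = - dF(X)], which is the reduced
    bracket. *)

(** * Differential calculus *)

Section Calculus.
Context {R : realType}.
Implicit Types V W X : normedModType R.

(** Coordinate formulas hold only near a point, because a chart is inverted only on its domain. The
    first-order expansion of [f] is carried over to [g], and uniqueness of the differential does the
    rest. *)
Lemma near_eq_is_diff V W (f g df : V -> W) (x : V) :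
  {near x, f =1 g} -> is_diff x f df -> is_diff x g df.
Proof.
move=> fg [dfx fE]; have fgx := nbhs_singleton fg.
have gE : g \o shift x = cst (g x) + 'd f x +o_ 0 id.
  apply/eqaddoP => e e0; have /eqaddoP /(_ e e0) := diff_locally dfx.
  apply: filter_app; have := fg; rewrite (near_shift 0)/= => fg0.
  near=> h; rewrite -![(_ + _ : _ -> _) _]/(_ + _) -![(- _ : _ -> _) _]/(- _) /=.
  suff -> : f (h + x) = g (h + x) by rewrite /cst fgx.
  by near: h; apply: filterS fg0 => h /=; rewrite subr0.
have dE := diff_unique (diff_continuous dfx) gE.
apply: DiffDef; last by rewrite dE fE.
by apply/diff_locallyP; rewrite dE; split=> //; exact: diff_continuous.
Unshelve. all: by end_near. Qed.

Lemma is_diff_linear V W (f : {linear V -> W}) (x : V) :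
  continuous f -> is_diff x f f.
Proof. by move=> fc; split; [exact: linear_differentiable|exact: diff_lin]. Qed.

Lemma derive_diff V W (f df : V -> W) (x v : V) :
  is_diff x f df -> 'D_v f x = df v.
Proof. by move=> fd; rewrite deriveE // diff_val. Qed.

Lemma is_diff_ext V W (f g df dg : V -> W) (x : V) :
  is_diff x f df -> f =1 g -> df =1 dg -> is_diff x g dg.
Proof. by move=> fd /funext <- /funext <-. Qed.

Lemma is_diff_line V (x v z : V) (u : R) :
  is_diff u (fun t : R => x + t *: v + z) ( *:%R^~ v).
Proof.
have h := is_diffD (is_diffD (@is_diff_cst R R^o V x u) (is_diff_scalel u v))
  (@is_diff_cst R R^o V z u).
apply: (is_diff_ext h) => // t.
by rewrite -![(_ + _ : _ -> _) _]/(_ + _) add0r addr0.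
Qed.

Lemma is_derive_line V W (f : V -> W) (x v z : V) (u : R) :
  differentiable f (x + u *: v + z) ->
  is_derive u 1 (fun t : R => f (x + t *: v + z)) ('D_v f (x + u *: v + z)).
Proof.
move=> df; have dl := is_diff_line x v z u.
have dfl : is_diff u (f \o (fun t : R => x + t *: v + z))
    ('d f (x + u *: v + z) \o *:%R^~ v).
  by apply: is_diff_comp; exact: differentiableP.
split; first by apply: diff_derivable; exact: (@ex_diff _ _ _ _ _ _ _ dfl).
by rewrite (derive_diff _ dfl) /= scale1r deriveE.
Qed.

(* The mean value theorem in the direction [v] needs [f] differentiable only near
   [x], and ['D_v f] differentiable only at [x]. *)
Lemma second_difference V (f : V -> R^o) (x v w : V) :
    (\forall y \near x, differentiable f y) -> differentiable ('D_v f) x ->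
  forall e : R, 0 < e -> \forall s \near 0^'+,
  `|f (x + s *: v + s *: w) - f (x + s *: v) - (f (x + s *: w) - f x)
     - s ^+ 2 * 'D_w ('D_v f) x| <= e * s ^+ 2.
Proof.
(* All increments used below have norm at most [s * k]; the summand [1] keeps [k] positive when [v]
   and [w] vanish. *)
move=> df d2f e e0; pose k := `|v| + `|w| + 1.
have k0 : 0 < k by rewrite /k ltr_wpDl // addr_ge0.
(* The expansion of ['D_v f] is used at two points, each with error [e' * (s * k)]; together they
   make [e * s]. *)
pose e' := e / (2 * k); have e'0 : 0 < e' by rewrite divr_gt0 // mulr_gt0.
have /eqaddoP /(_ e' e'0) := diff_locally d2f.
move=> /nbhs_ballP[r r0 rP]; move/nbhs_ballP: df => [r' r'0 r'P].
near=> s.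
have s0 : 0 < s by [].
have small c : 0 <= c -> c <= s -> `|c *: v| + `|s *: w| <= s * k.
  move=> c0 cs; rewrite !normrZ !ger0_norm ?(ltW s0) // /k !mulrDr mulr1.
  by rewrite -addrA lerD ?ler_wpM2r // lerDl ltW.
have sr : s * k < Num.min r r'.
  rewrite -ltr_pdivlMr //; near: s; apply: nbhs_right_lt.
  by rewrite divr_gt0 // lt_min; apply/andP.
have near_d y : `|y| <= s * k -> differentiable f (x + y) /\
    `|'D_v f (x + y) - 'D_v f x - 'd ('D_v f) x y| <= e' * (s * k).
  move=> yk; have yr := le_lt_trans yk sr; rewrite lt_min in yr.
  case/andP: yr => yr yr'; split.
    by apply: r'P; rewrite -ball_normE /ball_ /= opprD addrA subrr sub0r normrN.
  have := rP y; rewrite -ball_normE /ball_ /= sub0r normrN => /(_ yr).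
  rewrite -![(_ + _ : _ -> _) _]/(_ + _) -![(- _ : _ -> _) _]/(- _) /=.
  rewrite opprD addrA [y + x]addrC => /le_trans; apply.
  by rewrite ler_pM2l.
(* The second difference is [phi s - phi 0], so a single use of the mean value theorem along [v]
   turns it into a difference of values of ['D_v f]. *)
pose phi (u : R) : R := f (x + u *: v + s *: w) - f (x + u *: v).
have dphi (u : R) : 0 <= u -> u <= s ->
    is_derive u 1 phi ('D_v f (x + u *: v + s *: w) - 'D_v f (x + u *: v)).
  move=> u0 us; have := small _ u0 us => usk.
  have d1 : differentiable f (x + u *: v + s *: w).
    by rewrite -addrA; apply: (near_d _ _).1; exact: le_trans (ler_normD _ _) usk.
  have d2 : differentiable f (x + u *: v).
    by apply: (near_d _ _).1; apply: le_trans usk; rewrite lerDl.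
  have shiftd z : differentiable f (x + u *: v + z) ->
      is_derive u 1 (fun t : R => f (x + t *: v + z)) ('D_v f (x + u *: v + z)).
    by move=> dz; exact: is_derive_line.
  apply: is_deriveB; first exact: shiftd.
  by have := shiftd 0; rewrite addr0; under eq_fun do rewrite addr0; apply.
have [c c01 phiE] : exists2 c, c \in `]0, s[%R & phi s - phi 0 =
    ('D_v f (x + c *: v + s *: w) - 'D_v f (x + c *: v)) * (s - 0).
  apply: MVT => //.
    by move=> u /itvP us; apply: dphi; rewrite ?us.
  apply: derivable_within_continuous => u /itvP us.
  by apply: (@ex_derive _ _ _ _ _ _ _ (dphi u _ _)); rewrite us.
have c0 : 0 <= c by rewrite (itvP c01).
have cs : c <= s by rewrite (itvP c01).
have csk := small c c0 cs.
have [_ h1] := near_d (c *: v + s *: w) (le_trans (ler_normD _ _) csk).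
have [_ h2] : differentiable f (x + c *: v) /\
    `|'D_v f (x + c *: v) - 'D_v f x - 'd ('D_v f) x (c *: v)| <= e' * (s * k).
  by apply: near_d; apply: le_trans csk; rewrite lerDl.
(* The intermediate point [c] cancels from the linear parts, which leaves exactly the expected
   second derivative. *)
have LE : 'd ('D_v f) x (c *: v + s *: w) - 'd ('D_v f) x (c *: v)
    = s * 'D_w ('D_v f) x.
  by rewrite linearD addrAC subrr add0r linearZ /= deriveE.
have -> : f (x + s *: v + s *: w) - f (x + s *: v) - (f (x + s *: w) - f x)
    = phi s - phi 0.
  by rewrite /phi scale0r !addr0.
rewrite phiE subr0.
have -> : ('D_v f (x + c *: v + s *: w) - 'D_v f (x + c *: v)) * s
     - s ^+ 2 * 'D_w ('D_v f) x =
   (('D_v f (x + (c *: v + s *: w)) - 'D_v f x - 'd ('D_v f) x (c *: v + s *: w))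
   - ('D_v f (x + c *: v) - 'D_v f x - 'd ('D_v f) x (c *: v))) * s.
  rewrite addrA expr2 -mulrA -LE; ring.
rewrite normrM (ger0_norm (ltW s0)) expr2 mulrA ler_pM2r //.
apply: le_trans (ler_normB _ _) _; apply: le_trans (lerD h1 h2) _.
suff -> : e' * (s * k) + e' * (s * k) = e * s by [].
by rewrite /e'; field; rewrite gt_eqF.
Unshelve. all: by end_near. Qed.

(* The second difference is symmetric in [v] and [w]. *)
Lemma derive_comm V (f : V -> R^o) (x v w : V) :
    (\forall y \near x, differentiable f y) ->
    differentiable ('D_v f) x -> differentiable ('D_w f) x ->
  'D_w ('D_v f) x = 'D_v ('D_w f) x.
Proof.
move=> df dv dw; apply/eqP; rewrite -subr_eq0 -normr_le0.
apply/ler_addgt0Pr => e e0; rewrite add0r.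
have e20 : 0 < e / 2 by rewrite divr_gt0.
have H1 := second_difference w df dv e20.
have H2 := second_difference v df dw e20.
have [s [[h1 h2] s_gt0]] := filter_ex (filterI (filterI H1 H2) (nbhs_right_gt 0)).
have {s_gt0} s0 : 0 < s ^+ 2 by rewrite exprn_gt0.
(* With the two increments exchanged, both estimates concern the same second difference. *)
rewrite (addrAC x (s *: w)) in h2.
move: ('D_w ('D_v f) x) ('D_v ('D_w f) x) (f (x + s *: v + s *: w))
  (f (x + s *: v)) (f (x + s *: w)) (f x) h1 h2 => L1 L2 a b c d h1 h2.
rewrite -(ler_pM2r s0) [leRHS](_ : _ = e / 2 * s ^+ 2 + e / 2 * s ^+ 2); last first.
  by field.
apply: le_trans (lerD h2 h1); apply: le_trans (ler_normB _ _).
rewrite -{1}(ger0_norm (ltW s0)) -normrM.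
rewrite le_eqVlt; apply/orP; left; apply/eqP; congr (`|_|); ring.
Qed.

Lemma continuous_is_diff V W (f df : V -> W) x :
  is_diff x f df -> {for x, continuous f}.
Proof. by move=> fd; apply: differentiable_continuous. Qed.

(** The base point [y] is given through an equation, since points such as the image of
    [lie_exp A (0 *: xi)] equal [x0] by proof and not by computation. *)
Lemma is_diff_comp_at V W X (f df : V -> W) (g dg : W -> X) x y :
  f x = y -> is_diff x f df -> is_diff y g dg -> is_diff x (g \o f) (dg \o df).
Proof. by move=> <-; exact: is_diff_comp. Qed.

Lemma is_diff_unique V W (f df dg : V -> W) (x : V) :
  is_diff x f df -> is_diff x f dg -> df =1 dg.
Proof. by move=> [_ <-] [_ <-]. Qed.

Lemma is_diff_fst V W X (f df : V -> W * X) x :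
  is_diff x f df -> is_diff x (fun y => (f y).1) (fun y => (df y).1).
Proof.
move=> fd; have := @is_diff_linear (W * X)%type W fst (f x).
move=> /(_ (fun y => cvg_fst)) h; exact: (is_diff_comp fd h).
Qed.

Lemma is_diff_snd V W X (f df : V -> W * X) x :
  is_diff x f df -> is_diff x (fun y => (f y).2) (fun y => (df y).2).
Proof.
move=> fd; have := @is_diff_linear (W * X)%type X snd (f x).
move=> /(_ (fun y => cvg_snd)) h; exact: (is_diff_comp fd h).
Qed.

Lemma is_diff_coord V m n (f df : V -> 'M[R]_(m, n)) x i j :
  is_diff x f df -> is_diff x (fun y => f y i j : R^o) (fun y => df y i j).
Proof.
move=> fd; pose e (N : 'M[R]_(m, n)) : R^o := N i j.
have elin : linear e by move=> a M N; rewrite /e !mxE.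
pose eM := GRing.isLinear.Build _ _ _ _ _ elin.
pose eL : {linear _ -> _} := HB.pack e eM.
have eLd : is_diff (f x) eL eL.
  by apply: is_diff_linear; exact: coord_continuous.
exact: (is_diff_comp fd eLd).
Qed.

Lemma differentiable_derive V W (f : V -> W) x :
  differentiable f x -> is_diff x f (fun v => 'D_v f x).
Proof.
by move=> fd; apply: (is_diff_ext (differentiableP fd)) => // v; rewrite deriveE.
Qed.

(** * Functions of class C^k *)

Lemma Ck_subset V W k (U U' : set V) (f : V -> W) :
  U' `<=` U -> Ck k U f -> Ck k U' f.
Proof.
move=> sU; elim: k f => [|k IH] f /=; first by move=> fc x /sU /fc.
by move=> [fd fD]; split=> [x /sU /fd //|v]; apply: IH.
Qed.

(** Derivatives of total functions are computed by formulas valid on [U] only. Openness turns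
    equality on [U] into equality near each point of [U], which passes to the derivatives. *)
Lemma eq_Ck V W k (U : set V) (f g : V -> W) : open U ->
  (forall x, U x -> f x = g x) -> Ck k U f -> Ck k U g.
Proof.
move=> oU; have near_eq (h h' : V -> W) x : (forall x, U x -> h x = h' x) ->
    U x -> {near x, h =1 h'}.
  by move=> hh' Ux; have := open_nbhs_nbhs (conj oU Ux); apply: filterS.
elim: k f g => [|k IH] f g fg /=.
  move=> fc x Ux; apply: cvg_trans (near_eq_cvg (near_eq _ _ _ fg Ux)) _.
  by rewrite -(fg x Ux); exact: fc.
have nfg x (Ux : U x) := near_eq _ _ x fg Ux.
move=> [fd fD]; split=> [x Ux|v].
  have fdx := differentiableP (fd x Ux).
  exact: (@ex_diff _ _ _ _ _ _ _ (near_eq_is_diff (nfg x Ux) fdx)).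
apply: IH (fD v) => x Ux; exact/near_eq_derive/nfg.
Qed.

Lemma Ck_cst V W k (U : set V) (c : W) : Ck k U (fun=> c).
Proof.
elim: k c => [|k IH] c /=; first by move=> x _; exact: cvg_cst.
split=> [x _|v]; first exact: differentiable_cst.
have -> // : (fun x => 'D_v (fun=> c) x) = (fun=> 0) :> (V -> W).
by apply/funext => x; exact: derive_cst.
Qed.

(** One [df] serves at every point, so each directional derivative is a constant function. *)
Lemma Ck_affine V W k (U : set V) (f df : V -> W) :
  (forall x, is_diff x f df) -> Ck k U f.
Proof.
move=> fd; case: k => [|k] /=; first by move=> x _; exact: continuous_is_diff.
split=> [x _|v]; first exact: (@ex_diff _ _ _ _ _ _ _ (fd x)).
have -> : (fun x => 'D_v f x) = (fun=> df v) :> (V -> W); last exact: Ck_cst.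
by apply/funext => x; exact: (derive_diff _ (fd x)).
Qed.

Lemma Ck_pair V W X k (U : set V) (f : V -> W) (g : V -> X) : open U ->
  Ck k U f -> Ck k U g -> Ck k U (fun x => (f x, g x)).
Proof.
move=> oU; elim: k f g => [|k IH] f g /=.
  by move=> fc gc x Ux; exact: cvg_pair (fc x Ux) (gc x Ux).
move=> [fd fD] [gd gD]; split=> [x Ux|v].
  by apply: differentiable_pair; [exact: fd|exact: gd].
apply: eq_Ck (IH _ _ (fD v) (gD v)) => // x Ux.
have := is_diff_pair (differentiableP (fd x Ux)) (differentiableP (gd x Ux)).
by move=> /(derive_diff v) ->; rewrite !deriveE; [|exact: gd|exact: fd].
Qed.

(** Since [dL] is the same everywhere, the derivative of [f \o L] along [v] is ['D_(dL v) f \o L],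
    again a composite with [L]; this closes the induction on [k]. *)
Lemma Ck_comp_affine V W X k (U : set V) (U' : set W) (L dL : V -> W) (f : W -> X) :
  open U -> (forall x, is_diff x L dL) -> (forall x, U x -> U' (L x)) ->
  Ck k U' f -> Ck k U (f \o L).
Proof.
move=> oU Ld UL; elim: k f => [|k IH] f /=.
  move=> fc x Ux; apply: continuous_comp; first exact: continuous_is_diff (Ld x).
  exact/fc/UL.
move=> [fd fD].
have d x : U x -> is_diff x (f \o L) ('d f (L x) \o dL).
  by move=> /UL /fd /differentiableP fdx; exact: is_diff_comp.
split=> [x Ux|v]; first exact: (@ex_diff _ _ _ _ _ _ _ (d x Ux)).
apply: eq_Ck (IH _ (fD (dL v))) => // x Ux /=.
by rewrite (derive_diff v (d x Ux)) deriveE //; exact/fd/UL.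
Qed.

(** * Derivatives of vector-valued maps *)

Lemma is_derive_rV V n (f : V -> 'rV[R]_n) (x v : V) (d : 'rV[R]_n) :
    (forall j, is_derive x v (fun y => f y 0 j : R^o) (d 0 j)) ->
  is_derive x v f d.
Proof.
move=> fd; have fv : derivable f x v.
  by apply/derivable_mxP => i j; rewrite ord1; exact: (@ex_derive _ _ _ _ _ _ _ (fd j)).
split=> //; rewrite derive_mx //; apply/rowP => j; rewrite mxE.
exact: (@derive_val _ _ _ _ _ _ _ (fd j)).
Qed.

Lemma derive_coord V n (f : V -> 'rV[R]_n) (x v : V) j : differentiable f x ->
  'D_v (fun y => f y 0 j : R^o) x = ('D_v f x) 0 j.
Proof.
by move=> /differentiable_derive /(is_diff_coord 0 j) /(derive_diff v).
Qed.

(** The scalar case is applied to each coordinate. Taking a coordinate commutes with the first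
    derivative on a neighbourhood of [x], and therefore also with the second derivative at [x]. *)
Lemma derive_comm_rV V n (f : V -> 'rV[R]_n) (x v w : V) :
    (\forall y \near x, differentiable f y) ->
    differentiable ('D_v f) x -> differentiable ('D_w f) x ->
  'D_w ('D_v f) x = 'D_v ('D_w f) x.
Proof.
move=> df dv dw; apply/rowP => j.
have coordD u : differentiable ('D_u f) x ->
    is_diff x ('D_u (fun y => f y 0 j : R^o)) (fun t => 'D_t ('D_u f) x 0 j).
  move=> /differentiable_derive /(is_diff_coord 0 j); apply: near_eq_is_diff.
  by apply: filterS df => y fy /=; rewrite derive_coord.
have hv := coordD v dv; have hw := coordD w dw.
apply: etrans (esym (derive_diff w hv)) _.
apply: etrans _ (derive_diff v hw).
apply: derive_comm.
- apply: filterS df => y /differentiableP /(is_diff_coord 0 j) h.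
  exact: (@ex_diff _ _ _ _ _ _ _ h).
- exact: (@ex_diff _ _ _ _ _ _ _ hv).
- exact: (@ex_diff _ _ _ _ _ _ _ hw).
Qed.

Lemma is_diff_is_derive V W (f df : V -> W) (x v : V) :
  is_diff x f df -> is_derive x v f (df v).
Proof.
by move=> fd; split; [exact/diff_derivable/ex_diff|exact: derive_diff].
Qed.

Lemma is_derive_coord V p q (f : V -> 'M[R]_(p, q)) (x v : V) d i j :
  is_derive x v f d -> is_derive x v (fun y => f y i j : R^o) (d i j).
Proof.
move=> [fd <-]; split; first exact: ((derivable_mxP _ _ _).1 fd).
by rewrite derive_mx // mxE.
Qed.

(** The product rule in the form in which [Ad] is differentiated along the exponential: moving
    scalar coefficients times moving vectors. *)
Lemma is_derive_sum_scale k n (w : 'I_k -> R -> R^o) (P : 'I_k -> R -> 'rV[R]_n)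
    (dw : 'I_k -> R) (dP : 'I_k -> 'rV[R]_n) (t : R) :
    (forall j, is_derive t 1 (w j) (dw j)) -> (forall j, is_derive t 1 (P j) (dP j)) ->
  is_derive t 1 (fun s => \sum_j w j s *: P j s)
    (\sum_j (w j t *: dP j + dw j *: P j t)).
Proof.
move=> wd Pd; apply: is_derive_rV => i.
have h j : is_derive t 1 (fun s => w j s * P j s 0 i : R^o)
    ((w j t *: dP j + dw j *: P j t) 0 i).
  have Pi := is_derive_coord 0 i (Pd j).
  have wP := is_deriveM (wd j) Pi; apply: (is_derive_eq wP).
  by rewrite !mxE; congr (_ + _); rewrite -[LHS]/(_ * _) mulrC.
have hs := is_derive_sum h.
rewrite (_ : (fun s => _) = \sum_j (fun s => w j s * P j s 0 i : R^o)); last first.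
  by apply/funext => s; rewrite fct_sumE summxE; apply: eq_bigr => j _; rewrite mxE.
by rewrite summxE.
Qed.

End Calculus.

(** * Local representatives *)

Section LocalRepresentative.
Context {R : realType}.

(** The coordinate expression of [f]. The charts are chosen independently of the point at which it
    is studied, so that one chart at [1] serves a whole neighbourhood, whereas [tangent] centres its
    charts at [x] and [f x]. *)
Definition locrep {T T' : topologicalType} {V V' : normedModType R}
    (A : atlas T V) (A' : atlas T' V') (p : T) (q : T') (f : T -> T') : V -> V' :=
  fun v => chart A' q (f (ichart A p v)).

Lemma near_chart (T : topologicalType) (V : normedModType R) (A : atlas T V) p x :
    smooth_atlas A -> cdom A p x ->
  \forall v \near chart A p x, cdom A p (ichart A p v) /\ chart A p (ichart A p v) = v.
Proof.
move=> hA px.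
have o : nbhs (chart A p x) (chart A p @` cdom A p).
  by apply: open_nbhs_nbhs; split; [exact: codom_open|exists x].
by apply: filterS o => _ [y py <-]; rewrite chartK.
Qed.

Lemma ichart_cvg (T : topologicalType) (V : normedModType R) (A : atlas T V) p x :
  smooth_atlas A -> cdom A p x -> ichart A p @ chart A p x --> x.
Proof.
move=> hA px.
have c : ichart A p @ chart A p x --> ichart A p (chart A p x).
  by apply: (ichart_continuous hA); exists x.
by rewrite chartK in c.
Qed.

Lemma open_chart_image (T : topologicalType) (V : normedModType R) (A : atlas T V)
    p (O : set T) : smooth_atlas A -> open O ->
  open (chart A p @` (cdom A p `&` O)).
Proof.
move=> hA oO; rewrite openE => _ [x [px Ox] <-]; rewrite /interior /=.
near=> v; exists (ichart A p v); last first.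
  by near: v; apply: filterS (near_chart hA px) => v [].
split; first by near: v; apply: filterS (near_chart hA px) => v [].
near: v; apply: (ichart_cvg hA px); exact: open_nbhs_nbhs.
Unshelve. all: by end_near. Qed.

Lemma smooth_map_locrep (T T' : topologicalType) (V V' : normedModType R)
    (A : atlas T V) (A' : atlas T' V') p q f x : smooth_map A A' f ->
  cdom A p x -> cdom A' q (f x) -> differentiable (locrep A A' p q f) (chart A p x).
Proof. by move=> [_ /(_ p q 1)[+ _]] px qfx; apply; exists x. Qed.

Lemma is_diff_locrep_id (T : topologicalType) (V : normedModType R) (A : atlas T V)
    p x : smooth_atlas A -> cdom A p x ->
  is_diff (chart A p x) (locrep A A p p id) id.
Proof.
move=> hA px; apply: near_eq_is_diff (is_diff_id _).
by apply: filterS (near_chart hA px) => v [_ vE]; rewrite /locrep /= vE.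
Qed.

(** The chain rule in charts. The middle chart cancels as long as [f] stays in [cdom A' q], and
    continuity at [x] ensures this near the point. *)
Lemma is_diff_locrep_comp (T T' T'' : topologicalType) (V V' V'' : normedModType R)
    (A : atlas T V) (A' : atlas T' V') (A'' : atlas T'' V'') p q r f g x df dg :
    smooth_atlas A -> smooth_atlas A' ->
    {for x, continuous f} -> cdom A p x -> cdom A' q (f x) ->
    is_diff (chart A p x) (locrep A A' p q f) df ->
    is_diff (chart A' q (f x)) (locrep A' A'' q r g) dg ->
  is_diff (chart A p x) (locrep A A'' p r (g \o f)) (dg \o df).
Proof.
move=> hA hA' fc px qfx fd gd.
have E : locrep A A' p q f (chart A p x) = chart A' q (f x).
  by rewrite /locrep chartK.
apply: near_eq_is_diff (is_diff_comp_at E fd gd).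
near=> v; rewrite /locrep /= chartK //; near: v.
have fi : (f \o ichart A p) v @[v --> chart A p x] --> f x.
  exact: cvg_comp (ichart_cvg hA px) fc.
apply: fi; apply: open_nbhs_nbhs; split=> //; exact: cdom_open.
Unshelve. all: by end_near. Qed.

End LocalRepresentative.

(** * Multiplication and translations of the group in charts *)

Section LieGroupChart.
Context {R : realType} {n : nat} {G : groupTopType}.
Variable A : atlas G 'rV[R]_n.
Hypothesis hG : lie_group A.
Let V := 'rV[R]_n.
Let hA := lie_atlas hG.

Let mulG (p : G * G) : G := (p.1 * p.2)%g.

Lemma lie_mul_cvg (a b : G) (T : Type) (F : set_system T) (f g : T -> G)
    {FF : Filter F} :
  f @ F --> a -> g @ F --> b -> (f t * g t)%g @[t --> F] --> (a * b)%g.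
Proof.
move=> fa gb; have mc := (lie_mul_smooth hG).1 (a, b).
apply: (@cvg_comp _ _ _ (fun t => (f t, g t)) mulG _ (nbhs (a, b))) mc.
exact: cvg_pair fa gb.
Qed.

Lemma lie_mull_continuous (g : G) : continuous (fun h : G => (g * h)%g).
Proof. by move=> h; apply: lie_mul_cvg; [exact: cvg_cst|exact: cvg_id]. Qed.

Lemma lie_mulr_continuous (g : G) : continuous (fun h : G => (h * g)%g).
Proof. by move=> h; apply: lie_mul_cvg; [exact: cvg_id|exact: cvg_cst]. Qed.

Definition mul_rep (p q r : G) : V * V -> V :=
  locrep (prod_atlas A A) A (p, q) r mulG.

Lemma mul_rep_diff p q r a b : cdom A p a -> cdom A q b -> cdom A r (a * b)%g ->
  differentiable (mul_rep p q r) (chart A p a, chart A q b).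
Proof.
move=> pa qb rab.
exact: (@smooth_map_locrep _ _ _ _ _ _ _ (p, q) r _ (a, b) (lie_mul_smooth hG)).
Qed.

Lemma derive_mul_rep_diff p q r a b v :
    cdom A p a -> cdom A q b -> cdom A r (a * b)%g ->
  differentiable ('D_v (mul_rep p q r)) (chart A p a, chart A q b).
Proof.
(* Smoothness is used at order [2]: each directional derivative is then of class C^1. *)
move=> pa qb rab; have [_ /(_ v)[+ _]] := (lie_mul_smooth hG).2 (p, q) r 2.
by apply; exists (a, b).
Qed.

(** A left translation is the multiplication with its first coordinate frozen, so its differential
    is a partial differential of [mul_rep]. *)
Lemma lie_mull_diff p q r g h : cdom A p g -> cdom A q h -> cdom A r (g * h)%g ->
  is_diff (chart A q h) (locrep A A q r (fun h : G => (g * h)%g))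
    (fun w => 'd (mul_rep p q r) (chart A p g, chart A q h) (0, w)).
Proof.
move=> pg qh rgh; have md := differentiableP (mul_rep_diff pg qh rgh).
have pd : is_diff (chart A q h) (fun w : V => (chart A p g, w)) (fun w => (0, w)).
  by have := is_diff_pair (is_diff_cst (chart A p g) (chart A q h)) (is_diff_id _).
apply: (is_diff_ext (is_diff_comp pd md)) => // w /=.
by rewrite /mul_rep /locrep /mulG /= chartK.
Qed.

Lemma lie_mulr_diff p q r g h : cdom A p h -> cdom A q g -> cdom A r (h * g)%g ->
  is_diff (chart A p h) (locrep A A p r (fun h : G => (h * g)%g))
    (fun w => 'd (mul_rep p q r) (chart A p h, chart A q g) (w, 0)).
Proof.
move=> ph qg rhg; have md := differentiableP (mul_rep_diff ph qg rhg).
have pd : is_diff (chart A p h) (fun w : V => (w, chart A q g)) (fun w => (w, 0)).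
  by have := is_diff_pair (is_diff_id _) (is_diff_cst (chart A q g) (chart A p h)).
apply: (is_diff_ext (is_diff_comp pd md)) => // w /=.
by rewrite /mul_rep /locrep /mulG /= chartK.
Qed.

(** [TR] reads its values in the chart at [1 * g]; once this is rewritten to [g], the chain rule
    applies to it. *)
Lemma TR_diff g : is_diff (chart A 1%g 1%g)
  (locrep A A 1%g g (fun h : G => (h * g)%g)) (TR A g).
Proof.
have c1 := cdom_center hA; apply: DiffDef; last by rewrite /TR /tangent mul1g.
have h : cdom A g (1 * g)%g by rewrite mul1g.
exact: (@ex_diff _ _ _ _ _ _ _ (lie_mulr_diff (c1 1%g) (c1 g) h)).
Qed.

Lemma TRinv_diff g : is_diff (chart A g g)
  (locrep A A g 1%g (fun h : G => (h * g^-1)%g)) (TRinv A g).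
Proof.
have c1 := cdom_center hA; apply: DiffDef; last by rewrite /TRinv /tangent mulgV.
have h : cdom A 1%g (g * g^-1)%g by rewrite mulgV.
exact: (@ex_diff _ _ _ _ _ _ _ (lie_mulr_diff (c1 g) (c1 g^-1)%g h)).
Qed.

(** The chain rule applied to the identity [h * g^-1 * g = h]. *)
Lemma TRinvK g : cancel (TRinv A g) (TR A g).
Proof.
have c1 := cdom_center hA; move=> v.
have TRg : is_diff (chart A 1%g (g * g^-1)%g)
    (locrep A A 1%g g (fun h : G => (h * g)%g)) (TR A g).
  by rewrite mulgV; exact: TR_diff.
have c : cdom A 1%g (g * g^-1)%g by rewrite mulgV.
have h := is_diff_locrep_comp hA hA (@lie_mulr_continuous _ _) (c1 g) c (TRinv_diff g) TRg.
have E : ((fun h => h * g)%g \o (fun h => h * g^-1)%g) = id :> (G -> G).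
  by apply/funext => h0 /=; rewrite -mulgA mulVg mulg1.
rewrite E in h; exact: (is_diff_unique h (is_diff_locrep_id hA (c1 g))).
Qed.

Lemma TRK g : cancel (TR A g) (TRinv A g).
Proof.
have c1 := cdom_center hA; move=> v.
have TRg : is_diff (chart A g (1 * g)%g)
    (locrep A A g 1%g (fun h : G => (h * g^-1)%g)) (TRinv A g).
  by rewrite mul1g; exact: TRinv_diff.
have c : cdom A g (1 * g)%g by rewrite mul1g.
have h := is_diff_locrep_comp hA hA (@lie_mulr_continuous _ _) (c1 1%g) c (TR_diff g) TRg.
have E : ((fun h => h * g^-1)%g \o (fun h => h * g)%g) = id :> (G -> G).
  by apply/funext => h0 /=; rewrite -mulgA mulgV mulg1.
rewrite E in h; exact: (is_diff_unique h (is_diff_locrep_id hA (c1 1%g))).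
Qed.

End LieGroupChart.

(** * The Lie bracket in the chart at the identity *)

Section LieBracket.
Context {R : realType} {n : nat} {G : groupTopType}.
Variable A : atlas G 'rV[R]_n.
Hypothesis hG : lie_group A.
Local Notation V := ('rV[R]_n).
Let hA := lie_atlas hG.

Local Notation chart1 := (chart A 1%g).
Local Notation x0 := (chart A 1%g 1%g).
Local Notation m := (mul_rep A 1%g 1%g 1%g).

Lemma cdom1_mul1r a : cdom A 1%g a -> cdom A 1%g (a * 1)%g.
Proof. by rewrite mulg1. Qed.

Lemma cdom1_mul1l a : cdom A 1%g a -> cdom A 1%g (1 * a)%g.
Proof. by rewrite mul1g. Qed.

(** Symmetry of second derivatives at [(x0, x0)] asks for differentiability of [m] on a
    neighbourhood. Continuity of the multiplication keeps nearby products in the chart domain. *)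
Lemma near_mul_rep : \forall z \near (x0, x0), exists a b : G,
  [/\ cdom A 1%g a, cdom A 1%g b, cdom A 1%g (a * b)%g & z = (chart1 a, chart1 b)].
Proof.
have c1 := cdom_center hA 1%g; have n1 := near_chart hA c1.
have f1 : (z : V * V).1 @[z --> (x0, x0)] --> x0 by exact: cvg_fst.
have f2 : (z : V * V).2 @[z --> (x0, x0)] --> x0 by exact: cvg_snd.
have i1 := cvg_comp _ _ f1 (ichart_cvg hA c1).
have i2 := cvg_comp _ _ f2 (ichart_cvg hA c1).
have i12 : (ichart A 1 (z : V * V).1 * ichart A 1 z.2)%g @[z --> (x0, x0)] --> (1 * 1 : G)%g.
  exact: (@lie_mul_cvg _ _ _ _ hG _ _ _ _ _ _ _ i1 i2).
rewrite mulg1 in i12.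
have N12 := i12 _ (open_nbhs_nbhs (conj (cdom_open hA 1%g) c1)).
near=> z; have [a1 b1] : cdom A 1%g (ichart A 1%g z.1) /\ chart1 (ichart A 1%g z.1) = z.1.
  by near: z; exact: f1 _ n1.
have [a2 b2] : cdom A 1%g (ichart A 1%g z.2) /\ chart1 (ichart A 1%g z.2) = z.2.
  by near: z; exact: f2 _ n1.
exists (ichart A 1%g z.1), (ichart A 1%g z.2); split => //; first by near: z.
by rewrite b1 b2 -surjective_pairing.
Unshelve. all: by end_near. Qed.

(** Right translation by [1] is the identity map, and so is its differential. *)
Lemma d_mul_rep_r1 a v : cdom A 1%g a -> 'd m (chart1 a, x0) (v, 0) = v.
Proof.
move=> a1; have c1 := cdom_center hA 1%g.
have h := lie_mulr_diff hG a1 c1 (cdom1_mul1r a1).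
have E : (fun h : G => (h * 1)%g) = id by apply/funext => g; rewrite mulg1.
rewrite E in h; exact: (is_diff_unique h (is_diff_locrep_id hA a1)).
Qed.

Lemma d_mul_rep_1l a v : cdom A 1%g a -> 'd m (x0, chart1 a) (0, v) = v.
Proof.
move=> a1; have c1 := cdom_center hA 1%g.
have h := lie_mull_diff hG c1 a1 (cdom1_mul1l a1).
have E : (fun h : G => (1 * h)%g) = id by apply/funext => g; rewrite mul1g.
rewrite E in h; exact: (is_diff_unique h (is_diff_locrep_id hA a1)).
Qed.

Lemma d_mul_rep_11 v w : 'd m (x0, x0) (v, w) = v + w.
Proof.
have c1 := cdom_center hA 1%g.
have -> : (v, w) = (v, 0) + (0, w) by congr pair; rewrite ?addr0 ?add0r.
by rewrite linearD d_mul_rep_r1 // d_mul_rep_1l.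
Qed.

(** The two translations composing the conjugation are both read in the chart at [1], so that the
    single function [m] describes [Ad] for all [a] near [1]. *)
Lemma Ad_mul_rep a eta : cdom A 1%g a -> cdom A 1%g a^-1%g ->
  Ad A a eta = 'd m (chart1 a, chart1 a^-1%g) ('d m (chart1 a, x0) (0, eta), 0).
Proof.
move=> a1 a1'; have c1 := cdom_center hA 1%g.
have h1 := lie_mull_diff hG a1 c1 (cdom1_mul1r a1).
have c : cdom A 1%g (a * 1 * a^-1)%g by rewrite mulg1 mulgV.
have h2 := lie_mulr_diff hG (cdom1_mul1r a1) a1' c.
have h := is_diff_locrep_comp hA hA (@lie_mull_continuous _ _ _ _ hG _ _) c1
  (cdom1_mul1r a1) h1 h2.
rewrite /Ad /tangent; have -> : (a * 1 * a^-1)%g = 1%g by rewrite mulg1 mulgV.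
by rewrite (@diff_val _ _ _ _ _ _ _ h) /= mulg1.
Qed.

(* The default value of [lie_exp] also has velocity [xi] at [t = 0], so the two cases
   of [xget] can be treated without proving that the exponential map exists. *)
Lemma lie_exp_curve xi : [/\ lie_exp A (0 *: xi) = 1%g,
  lie_exp A (t *: xi) @[t --> (0 : R)] --> (1%g : G) &
  is_diff (0 : R) (fun t : R => chart1 (lie_exp A (t *: xi))) ( *:%R^~ xi)].
Proof.
have c1 := cdom_center hA 1%g.
have [[e eP]|nE] := pselect (exists e, exponential_map A e).
  have {eP}/(_ xi)[es eD eT] : exponential_map A (lie_exp A).
    by apply: (@xgetPex _ _ [set e | exponential_map A e]); exists e.
  have e0 : lie_exp A (0 *: xi) = 1%g.
    (* The homomorphism law at [0 + 0] makes this element idempotent, hence equal to [1]. *)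
    have := eD 0 0; rewrite addr0 => /(congr1 (fun g => (lie_exp A (0 *: xi))^-1 * g)%g).
    by rewrite mulVg mulKg.
  split=> //; first by rewrite -e0; exact: (es.1 0).
  have c0 : cdom A 1%g (lie_exp A ((0 : R^o) *: xi)) by rewrite e0.
  have d := @smooth_map_locrep R _ _ _ _ _ _ (0 : R^o) 1%g _ (0 : R^o) es I c0.
  apply: DiffDef; first exact: d.
  apply/funext => t; rewrite /tangent /= e0 in eT.
  by rewrite -[t in LHS]mulr1 -[t * 1]/(t *: (1 : R^o)) linearZ /= eT.
have E t : lie_exp A (t *: xi) = ichart A 1%g (x0 + t *: xi).
  by rewrite /lie_exp xgetPN // => e /= eP; apply: nE; exists e.
have ld := is_diff_line x0 xi 0 (0 : R).
have lc : (fun t : R => x0 + t *: xi) @ (0 : R) --> x0.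
  have : (fun t : R => x0 + t *: xi + 0) @ (0 : R) --> x0 + (0 : R) *: xi + 0.
    exact: continuous_is_diff ld.
  by rewrite scale0r !addr0; under eq_fun do rewrite addr0.
split; first by rewrite E scale0r addr0 chartK.
  under eq_fun do rewrite E.
  exact: cvg_comp _ _ lc (ichart_cvg hA c1).
apply: near_eq_is_diff ld; have N := lc _ (near_chart hA c1).
near=> t; have [_ tE] : cdom A 1%g (ichart A 1%g (x0 + t *: xi)) /\
    chart1 (ichart A 1%g (x0 + t *: xi)) = x0 + t *: xi by near: t.
by rewrite E tE addr0.
Unshelve. all: by end_near. Qed.

(** Places the exponential curve within the scope of [Ad_mul_rep] for small [t]. *)
Lemma near_lie_exp xi : \forall t \near (0 : R),
  cdom A 1%g (lie_exp A (t *: xi)) /\ cdom A 1%g (lie_exp A (t *: xi))^-1%g.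
Proof.
have c1 := cdom_center hA 1%g; have [_ ec _] := lie_exp_curve xi.
have ecV : (lie_exp A (t *: xi))^-1%g @[t --> (0 : R)] --> (1^-1 : G)%g.
  exact: cvg_comp _ _ ec ((lie_inv_smooth hG).1 1%g).
rewrite invg1 in ecV; have o := open_nbhs_nbhs (conj (cdom_open hA 1%g) c1).
have h1 := ec _ o; have h2 := ecV _ o; near=> t.
by split; near: t.
Unshelve. all: by end_near. Qed.

(** Smoothness of the inversion gives some velocity [u]. Differentiating [g * g^-1 = 1] along the
    curve gives [xi + u = 0], an argument valid for every curve through [1] with velocity [xi],
    including the default value of [lie_exp]. *)
Lemma lie_exp_curveV xi :
  is_diff (0 : R) (fun t : R => chart1 (lie_exp A (t *: xi))^-1%g) (fun t => - (t *: xi)).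
Proof.
have c1 := cdom_center hA 1%g; have [e0 ec ed] := lie_exp_curve xi.
have cV : cdom A 1%g (1^-1 : G)%g by rewrite invg1.
have Id := differentiableP (smooth_map_locrep (lie_inv_smooth hG) c1 cV).
pose u := 'd (locrep A A 1%g 1%g (fun g : G => g^-1%g)) x0 xi.
have dd : is_diff (0 : R) (fun t : R => chart1 (lie_exp A (t *: xi))^-1%g) ( *:%R^~ u).
  have cE : chart1 (lie_exp A ((0 : R) *: xi)) = x0 by rewrite e0.
  apply: (is_diff_ext (near_eq_is_diff _ (is_diff_comp_at cE ed Id))).
  - by apply: filterS (near_lie_exp xi) => t [t1 _]; rewrite /= /locrep chartK.
  - by [].
  - by move=> t; rewrite /= linearZ.
have md : is_diff (x0, x0) m ('d m (x0, x0)).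
  exact/differentiableP/mul_rep_diff/cdom1_mul1l.
have pd := is_diff_pair ed dd.
have E : (chart1 (lie_exp A ((0 : R) *: xi)), chart1 (lie_exp A ((0 : R) *: xi))^-1%g)
    = (x0, x0) by rewrite e0 invg1.
have h := is_diff_comp_at E pd md.
have h' : is_diff (0 : R) (fun _ : R => x0) (fun _ => 0).
  exact: is_diff_cst.
have near_cst : \forall t \near (0 : R), x0 = (m \o (fun t : R =>
    (chart1 (lie_exp A (t *: xi)), chart1 (lie_exp A (t *: xi))^-1%g))) t.
  apply: filterS (near_lie_exp xi) => t [t1 t1'].
  by rewrite /= /mul_rep /locrep /= !chartK // mulgV.
have /(_ 1) /= := is_diff_unique (near_eq_is_diff near_cst h') h.
rewrite !scale1r d_mul_rep_11 // => xu.
have uE : u = - xi by apply/eqP; rewrite -addr_eq0 addrC -xu.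
by apply: (is_diff_ext dd) => // t; rewrite uE scalerN.
Qed.

(** Replaces a moving vector argument by moving scalar coefficients on fixed basis directions, as
    the product rule for [Ad] requires. *)
Lemma linear_pair_sum (W : lmodType R) (f : {linear (V * V)%type -> W}) (w : V) :
  f (w, 0) = \sum_j w 0 j *: f (delta_mx 0 j, 0).
Proof.
under eq_bigr do rewrite -linearZ; rewrite -linear_sum; congr (f _).
rewrite [w in LHS]row_sum_delta; elim/big_ind2: _ => //= [a b c d <- <-|j _].
  by congr pair; rewrite addr0.
by congr pair; rewrite scaler0.
Qed.

(* [m (x, x0) = x], so ['D_(w, 0) m (x, x0)] is constant in [x]. *)
Lemma mul_rep_cross_r1 v w : 'd ('D_(w, 0) m) (x0, x0) (v, 0) = 0.
Proof.
have c1 := cdom_center hA 1%g.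
have md := differentiableP (derive_mul_rep_diff hG (w, 0) c1 c1 (cdom1_mul1l c1)).
have pd : is_diff x0 (fun x : V => (x, x0)) (fun v => (v, 0)).
  exact: is_diff_pair (is_diff_id _) (is_diff_cst x0 x0).
have h := is_diff_comp pd md.
have near_cst : \forall x \near x0, ('D_(w, 0) m \o (fun x : V => (x, x0))) x = w.
  apply: filterS (near_chart hA c1) => x [x1 xE].
  rewrite /= -xE deriveE; last exact: (mul_rep_diff hG x1 c1 (cdom1_mul1r x1)).
  exact: d_mul_rep_r1.
have h' := near_eq_is_diff near_cst h.
exact: (is_diff_unique h' (is_diff_cst w x0)).
Qed.

Lemma mul_rep_cross_comm v w :
  'd ('D_(v, 0) m) (x0, x0) (0, w) = 'd ('D_(0, w) m) (x0, x0) (v, 0).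
Proof.
have c1 := cdom_center hA 1%g.
have md u := derive_mul_rep_diff hG u c1 c1 (cdom1_mul1l c1).
apply: etrans (esym (deriveE _ (md (v, 0)))) _.
apply: etrans _ (deriveE _ (md (0, w))).
apply: derive_comm_rV.
- apply: filterS near_mul_rep => _ [a [b [a1 b1 ab1 ->]]]; exact: mul_rep_diff.
- exact: md.
- exact: md.
Qed.

(** Near [t = 0], [Ad] is the sum of the [w j t *: P j t]: the [w j] are the coordinates of the
    left-translated [eta], and [P j] is the right translation applied to a basis vector. At [t = 0]
    these are the coordinates of [eta] and the basis itself, so the derivative of [w] gives the
    first term and that of [P] the second. *)
Lemma bracketE xi eta : bracket A xi eta =
  'd ('D_(0, eta) m) (x0, x0) (xi, 0) - 'd ('D_(0, xi) m) (x0, x0) (eta, 0).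
Proof.
have c1 := cdom_center hA 1%g; have [e0 _ cd] := lie_exp_curve xi.
have dd := lie_exp_curveV xi.
pose c (t : R) := chart1 (lie_exp A (t *: xi)).
pose d (t : R) := chart1 (lie_exp A (t *: xi))^-1%g.
pose w j (t : R) : R^o := 'D_(0, eta) m (c t, x0) 0 j.
pose P j (t : R) := 'D_(delta_mx 0 j : V, 0) m (c t, d t).
have AdE : \forall t \near (0 : R),
    \sum_j w j t *: P j t = Ad A (lie_exp A (t *: xi)) eta.
  apply: filterS (near_lie_exp xi) => t [t1 tV1].
  rewrite Ad_mul_rep // linear_pair_sum; apply: eq_bigr => j _.
  rewrite /w /P !deriveE //; last exact: (mul_rep_diff hG t1 c1 (cdom1_mul1r t1)).
  by apply: (mul_rep_diff hG t1 tV1); rewrite mulgV.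
have md u := differentiableP (derive_mul_rep_diff hG u c1 c1 (cdom1_mul1l c1)).
have wd j : is_derive (0 : R) 1 (w j) ('d ('D_(0, eta) m) (x0, x0) (xi, 0) 0 j).
  have pd := is_diff_pair cd (is_diff_cst x0 (0 : R)).
  have E : (chart1 (lie_exp A ((0 : R) *: xi)), x0) = (x0, x0) by rewrite e0.
  have h := is_diff_is_derive (1 : R^o) (is_diff_comp_at E pd (md (0, eta))).
  by have := is_derive_coord 0 j h; rewrite /= scale1r.
have Pd j : is_derive (0 : R) 1 (P j)
    (- 'd ('D_(0, xi) m) (x0, x0) (delta_mx 0 j, 0)).
  have pd := is_diff_pair cd dd.
  have E : (c 0, d 0) = (x0, x0) by rewrite /c /d e0 invg1.
  have h := is_diff_is_derive (1 : R^o) (is_diff_comp_at E pd (md (delta_mx 0 j, 0))).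
  apply: (is_derive_eq h) => /=; rewrite scale1r.
  (* The base point moves with velocity [(xi, - xi)]. Its first part contributes nothing by
     [mul_rep_cross_r1]; symmetry of second derivatives rewrites the other part. *)
  have -> : (xi, - xi) = (xi, 0) - (0, xi) :> V * V.
    by congr pair; rewrite ?subr0 ?sub0r.
  apply: etrans (linearB _ _ _) _.
  apply: etrans (congr2 (fun a b => a - b) (mul_rep_cross_r1 xi (delta_mx 0 j))
    (mul_rep_cross_comm (delta_mx 0 j) xi)) _.
  exact: sub0r.
have h := near_eq_is_derive AdE (is_derive_sum_scale wd Pd).
rewrite /bracket derive1E (@derive_val _ _ _ _ _ _ _ h) big_split /= addrC.
congr (_ + _).
  rewrite [RHS]row_sum_delta; apply: eq_bigr => j _; congr (_ *: _).
  rewrite /P /c /d e0 invg1 deriveE; last exact: (mul_rep_diff hG c1 c1 (cdom1_mul1l c1)).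
  exact: d_mul_rep_r1.
rewrite [in RHS]linear_pair_sum -sumrN; apply: eq_bigr => j _.
rewrite scalerN /w /c e0 deriveE; last exact: (mul_rep_diff hG c1 c1 (cdom1_mul1l c1)).
by congr (- (_ *: _)); rewrite d_mul_rep_1l.
Qed.

Lemma bracketC xi eta : bracket A xi eta = - bracket A eta xi.
Proof. by rewrite !bracketE opprB. Qed.

(** In [bracketE] the vector [eta] is the direction of an inner derivative in the first term.
    Symmetry moves it into the argument of a differential, where linearity is visible. *)
Lemma bracket_linear xi : linear (bracket A xi).
Proof.
have lin (L1 L2 : {linear (V * V)%type -> V}) :
    linear (fun eta : V => L1 (0, eta) - L2 (eta, 0)).
  move=> a u v.
  have -> : (0, a *: u + v) = a *: (0, u) + (0, v) :> V * V.
    by congr pair; rewrite /= ?scaler0 ?addr0.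
  have -> : (a *: u + v, 0) = a *: (u, 0) + (v, 0) :> V * V.
    by congr pair; rewrite /= ?scaler0 ?addr0.
  by rewrite (linearP L1) (linearP L2) scalerBr opprD addrACA.
have E eta : bracket A xi eta =
    'd ('D_(xi, 0) m) (x0, x0) (0, eta) - 'd ('D_(0, xi) m) (x0, x0) (eta, 0).
  by rewrite bracketE; congr (_ - _); exact: (esym (mul_rep_cross_comm xi eta)).
by move=> a u v; rewrite !E; exact: lin.
Qed.

End LieBracket.

(** * Continuity of maps between products *)

Section SmoothMaps.
Context {R : realType}.

Lemma continuous_pair_fun (T U W : topologicalType) (f : T -> U) (g : T -> W) :
  continuous f -> continuous g -> continuous (fun x => (f x, g x)).
Proof. by move=> fc gc x; exact: cvg_pair (fc x) (gc x). Qed.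

Lemma continuous_fst_fun (T U W : topologicalType) (f : T -> U * W) :
  continuous f -> continuous (fun x => (f x).1).
Proof. by move=> fc x; apply: continuous_comp; [exact: fc|exact: cvg_fst]. Qed.

Lemma continuous_snd_fun (T U W : topologicalType) (f : T -> U * W) :
  continuous f -> continuous (fun x => (f x).2).
Proof. by move=> fc x; apply: continuous_comp; [exact: fc|exact: cvg_snd]. Qed.

Lemma continuous_id_fun (T : topologicalType) : continuous (fun x : T => x).
Proof. by move=> x; exact: cvg_id. Qed.

Lemma continuous_cst_fun (T U : topologicalType) (c : U) : continuous (fun _ : T => c).
Proof. by move=> x; exact: cvg_cst. Qed.

Lemma open_affine_preimage (V W : normedModType R) (L dL : V -> W) (U : set W) :
  (forall x, is_diff x L dL) -> open U -> open (L @^-1` U).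
Proof.
by move=> Ld oU; apply: open_comp oU => x _; exact: continuous_is_diff (Ld x).
Qed.

End SmoothMaps.

Ltac continuous_proj := repeat lazymatch goal with
  | |- continuous (fun x => pair _ _) => apply: continuous_pair_fun
  | |- continuous (fun x => fst (@?f x)) => apply: (@continuous_fst_fun _ _ _ f)
  | |- continuous (fun x => snd (@?f x)) => apply: (@continuous_snd_fun _ _ _ f)
  | |- continuous (@fst _ _) => exact: (continuous_fst_fun (@continuous_id_fun _))
  | |- continuous (@snd _ _) => exact: (continuous_snd_fun (@continuous_id_fun _))
  | |- continuous (fun x => x) => exact: continuous_id_fun
  | |- continuous (fun x => _) => exact: continuous_cst_fun
  end.

(** * The pairing of the Lie algebra with its dual *)

Section Pairing.
Context {R : realType} {n : nat}.
Local Notation lie := ('rV[R]_n).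
Local Notation dual := ('cV[R]_n).

Lemma pairing_linear (mu : dual) : linear (pairing mu : lie -> R^o).
Proof. by move=> k a b; rewrite /pairing mulmxDl -scalemxAl !mxE. Qed.

Lemma pairingNr (mu : dual) (a : lie) : pairing mu (- a) = - pairing mu a.
Proof. by rewrite /pairing mulNmx mxE. Qed.

Lemma pairing0l (a : lie) : pairing 0 a = 0.
Proof. by rewrite /pairing mulmx0 mxE. Qed.

Lemma pairing_covector (l : lie -> R) (a : lie) :
  linear (l : lie -> R^o) -> pairing (covector l) a = l a.
Proof.
move=> ll; pose lM := GRing.isLinear.Build _ _ _ _ (l : lie -> R^o) ll.
pose L : {linear lie -> R^o} := HB.pack (l : lie -> R^o) lM.
rewrite -[RHS]/(L a) [a in RHS]row_sum_delta linear_sum /pairing mxE.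
by apply: eq_bigr => j _; rewrite linearZ mxE.
Qed.

Lemma pairing_bidual_vector (l : dual -> R) (mu : dual) :
  linear (l : dual -> R^o) -> pairing mu (bidual_vector l) = l mu.
Proof.
move=> ll; pose lM := GRing.isLinear.Build _ _ _ _ (l : dual -> R^o) ll.
pose L : {linear dual -> R^o} := HB.pack (l : dual -> R^o) lM.
have muE : mu = \sum_i mu i 0 *: delta_mx i 0.
  by rewrite [LHS]matrix_sum_delta; apply: eq_bigr => i _; rewrite big_ord1.
rewrite -[RHS]/(L mu) [mu in RHS]muE linear_sum /pairing mxE.
by apply: eq_bigr => j _; rewrite linearZ mxE mulrC.
Qed.

End Pairing.

Ltac is_diff_proj := repeat lazymatch goal with
  | |- is_diff_def _ (fun y => pair _ _) _ => apply: is_diff_pair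
  | |- is_diff_def _ (fun y => fst (@?f y)) _ => apply: (@is_diff_fst _ _ _ _ f)
  | |- is_diff_def _ (fun y => snd (@?f y)) _ => apply: (@is_diff_snd _ _ _ _ f)
  | |- is_diff_def _ (@fst _ _) _ => exact: (is_diff_fst (is_diff_id _))
  | |- is_diff_def _ (@snd _ _) _ => exact: (is_diff_snd (is_diff_id _))
  | |- is_diff_def _ (fun y => y) _ => exact: is_diff_id
  | |- is_diff_def _ (fun y => _) _ => exact: is_diff_cst
  end.

(** * Reduction of the Tulczyjew form *)

Section Reduction.
Context {R : realType} {n : nat} {G : groupTopType}.
Variable A : atlas G 'rV[R]_n.
Hypothesis hG : lie_group A.
Let hA := lie_atlas hG.
Local Notation lie := ('rV[R]_n).
Local Notation dual := ('cV[R]_n).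
Local Notation TTG := (G * dual * lie * dual)%type.
Local Notation TTG_model := (lie * dual * lie * dual)%type.
Local Notation Red := (G * dual * dual)%type.
Local Notation Red_model := (lie * dual * dual)%type.

Lemma tulczyjew_formC z v w : tulczyjew_form A z v w = - tulczyjew_form A z w v.
Proof.
case: z => [[[g mu] xi] nu]; case: v => [[[vg vm] vx] vn]; case: w => [[[wg wm] wx] wn].
rewrite /tulczyjew_form bracketC // pairingNr; ring.
Qed.

(** * Differentials of functions on the trivialized bundles *)

Lemma smooth_fun_locrep (T : topologicalType) (V : normedModType R) (B : atlas T V)
    (E : T -> R^o) s : smooth_fun B E -> cdom B s s ->
  is_diff (chart B s s) (fun v => E (ichart B s v)) (differential B E s).
Proof.
move=> Es ss.
(* The index [0] of the target chart is arbitrary: every chart of [vatlas] is the identity. *)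
exact: (differentiableP (@smooth_map_locrep _ _ _ _ _ _ _ s (0 : R^o) _ s Es ss I)).
Qed.

Lemma differentialE (T : topologicalType) (V : normedModType R) (B : atlas T V)
    (E : T -> R^o) s df :
  is_diff (chart B s s) (fun v => E (ichart B s v)) df -> differential B E s = df.
Proof. by move=> [_ <-]. Qed.

Lemma differential_linear (T : topologicalType) (V : normedModType R) (B : atlas T V)
    (E : T -> R^o) s : linear (differential B E s : V -> R^o).
Proof. by move=> a u v; rewrite /differential /tangent linearP. Qed.

Lemma TTG_cdom z : cdom (TTG_atlas A) z z.
Proof. by case: z => [[[g mu] xi] nu]; split=> //; split=> //; split=> //; exact: cdom_center. Qed.

Lemma reduced_cdom s : cdom (reduced_atlas A) s s.
Proof. by case: s => [[g mu] nu]; split=> //; split=> //; exact: cdom_center. Qed.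

(** In the trivialization the action is affine with the identity as differential, so tangent vectors
    at [z] and at its translate have the same coordinates. *)
Lemma differential_translation (E : TTG -> R^o) a z : smooth_fun (TTG_atlas A) E ->
  differential (TTG_atlas A) (fun y => E (translation y a)) z
  = differential (TTG_atlas A) E (translation z a).
Proof.
move=> Es; have Ed := smooth_fun_locrep Es (TTG_cdom (translation z a)).
case: z Ed => [[[g mu] xi] nu] /= Ed; apply: differentialE => /=.
have Ld : is_diff (chart A g g, mu, xi, nu)
    (fun v : TTG_model => (v.1.1.1, v.1.1.2, v.1.2 + a, v.2)) id.
  have h : is_diff (chart A g g, mu, xi, nu) (fun v : TTG_model => v.1.2) (fun v => v.1.2).
    by is_diff_proj.
  have h' := is_diffD h (is_diff_cst a _).
  have h2 : is_diff (chart A g g, mu, xi, nu) (fun v : TTG_model => v.1.1) (fun v => v.1.1).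
    by is_diff_proj.
  have h3 : is_diff (chart A g g, mu, xi, nu) (fun v : TTG_model => v.2) (fun v => v.2).
    by is_diff_proj.
  apply: (is_diff_ext (is_diff_pair (is_diff_pair h2 h') h3)).
  - by move=> [[[v1 v2] v3] v4].
  - by move=> [[[v1 v2] v3] v4]; rewrite /= -[(_ + _) _]/(v3 + 0) addr0.
exact: (is_diff_comp Ld Ed).
Qed.

Lemma differential_reduction (E : Red -> R^o) z w : smooth_fun (reduced_atlas A) E ->
  differential (TTG_atlas A) (fun y => E (reduction_map y)) z w
  = differential (reduced_atlas A) E (reduction_map z) (w.1.1.1, w.1.1.2, w.2).
Proof.
move=> Es; have Ed := smooth_fun_locrep Es (reduced_cdom (reduction_map z)).
case: z Ed => [[[g mu] xi] nu] /= Ed.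
have Ld : is_diff (chart A g g, mu, xi, nu)
    (fun v : TTG_model => (v.1.1.1, v.1.1.2, v.2)) (fun v => (v.1.1.1, v.1.1.2, v.2)).
  by is_diff_proj.
by rewrite (@differentialE _ _ (TTG_atlas A) _ (g, mu, xi, nu) _ (is_diff_comp Ld Ed)).
Qed.

Lemma partial_gE (E : Red -> R^o) g mu nu w : smooth_fun (reduced_atlas A) E ->
  partial_g A E g mu nu w = differential (reduced_atlas A) E (g, mu, nu) (w, 0, 0).
Proof.
move=> Es; have Ed := smooth_fun_locrep Es (reduced_cdom (g, mu, nu)).
have Ld : is_diff (chart A g g) (fun v : lie => (v, mu, nu)) (fun v => (v, 0, 0)).
  by is_diff_proj.
by rewrite /partial_g (@differentialE _ _ A _ g _ (is_diff_comp Ld Ed)).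
Qed.

Lemma partial_nu_pairing (E : Red -> R^o) g mu nu k : smooth_fun (reduced_atlas A) E ->
  pairing k (partial_nu E g mu nu)
  = differential (reduced_atlas A) E (g, mu, nu) (0, 0, k).
Proof.
move=> Es; have Ed := smooth_fun_locrep Es (reduced_cdom (g, mu, nu)).
have Ld : is_diff nu (fun v : dual => (chart A g g, mu, v)) (fun v => (0, 0, v)).
  by is_diff_proj.
rewrite /partial_nu pairing_bidual_vector; last exact: differential_linear.
have h : is_diff nu (fun k : dual => E (g, mu, k))
    (fun v => differential (reduced_atlas A) E (g, mu, nu) (0, 0, v)).
  apply: (is_diff_ext (is_diff_comp Ld Ed)) => // v /=.
  by rewrite (chartK hA (cdom_center hA g)).
by rewrite (@differentialE _ _ (vatlas dual) _ nu _ h).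
Qed.

(** Each component is found by comparing the coefficients of one component of the test vector in the
    Hamiltonian equation. The second one is [0] because the pulled-back function is constant in
    [xi]. *)
Definition reduced_hamiltonian_vector (E : Red -> R^o) (z : TTG) : TTG_model :=
  let: (g, mu, _, nu) := z in
  let dE := differential (reduced_atlas A) E (g, mu, nu) in
  let b := partial_nu E g mu nu in
  (TR A g b, 0, bidual_vector (fun k => dE (0, k, 0)),
   covector (fun a => - dE (TR A g a, 0, 0) - pairing nu (bracket A b a))).

Lemma linear_split (D : Red_model -> R) (a : lie) (k l : dual) :
  linear (D : Red_model -> R^o) -> D (a, k, l) = D (a, 0, 0) + D (0, k, 0) + D (0, 0, l).
Proof.
move=> Dl; have DD u v : D (u + v) = D u + D v.
  by have := Dl 1 u v; rewrite !scale1r.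
by rewrite -!DD; congr D; congr (_, _, _) => /=; rewrite ?addr0 ?add0r.
Qed.

Lemma covector_pairing (E : Red -> R^o) g mu nu (b a : lie) :
  pairing (covector (fun c =>
    - differential (reduced_atlas A) E (g, mu, nu) (TR A g c, 0, 0)
    - pairing nu (bracket A b c))) a
  = - differential (reduced_atlas A) E (g, mu, nu) (TR A g a, 0, 0)
    - pairing nu (bracket A b a).
Proof.
rewrite pairing_covector // => k u v.
rewrite bracket_linear // pairing_linear.
have -> : (TR A g (k *: u + v), 0, 0)
    = k *: (TR A g u, 0, 0) + (TR A g v, 0, 0) :> Red_model.
  by congr (_, _, _) => /=; rewrite ?scaler0 ?addr0 // /TR /tangent linearP.
rewrite differential_linear; move: (differential _ _ _ _) (differential _ _ _ _)
  (pairing _ _) (pairing _ _) => p q r t.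
rewrite -![_ *: _]/(_ * _); ring.
Qed.

Lemma pairing_TRdual (E : Red -> R^o) g mu nu a : smooth_fun (reduced_atlas A) E ->
  pairing (TRdual A g (partial_g A E g mu nu)) a
  = differential (reduced_atlas A) E (g, mu, nu) (TR A g a, 0, 0).
Proof.
move=> Es; rewrite pairing_covector ?partial_gE //.
move=> k u v; rewrite !partial_gE // -differential_linear; congr differential.
by congr (_, _, _) => /=; rewrite ?scaler0 ?addr0 // /TR /tangent linearP.
Qed.

Lemma tulczyjew_form_reduced (E : Red -> R^o) z w : smooth_fun (reduced_atlas A) E ->
  tulczyjew_form A z (reduced_hamiltonian_vector E z) w
  = - differential (TTG_atlas A) (fun y => E (reduction_map y)) z w.
Proof.
move=> Es; rewrite differential_reduction //.
case: z w => [[[g mu] xi] nu] [[[wg wm] wx] wn] /=.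
rewrite TRK // covector_pairing TRinvK // pairing0l partial_nu_pairing //.
rewrite pairing_bidual_vector; last first.
  move=> a u v; rewrite -differential_linear; congr differential.
  by congr (_, _, _) => /=; rewrite ?scaler0 ?addr0.
rewrite [in RHS]linear_split; last exact: differential_linear.
ring.
Qed.

Lemma poisson_bracket_reduction (E F : Red -> R^o) z :
    smooth_fun (reduced_atlas A) E -> smooth_fun (reduced_atlas A) F ->
  poisson_bracket A (fun y => E (reduction_map y)) (fun y => F (reduction_map y)) z
  = reduced_bracket A E F (reduction_map z).
Proof.
move=> Es Fs; rewrite /poisson_bracket.
set X := hamiltonian_vector A _ z.
have XP w : tulczyjew_form A z X w
    = - differential (TTG_atlas A) (fun y => F (reduction_map y)) z w.
  move: w; apply: (@xgetPex _ _ [set v | forall w, tulczyjew_form A z v w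
    = - differential (TTG_atlas A) (fun y => F (reduction_map y)) z w]).
  (* The explicit solution shows that [xget] chooses from a nonempty set; from here on [X] is
     handled through its defining equation. *)
  by exists (reduced_hamiltonian_vector F z) => w; exact: tulczyjew_form_reduced.
rewrite -[LHS]opprK -tulczyjew_form_reduced // -tulczyjew_formC XP.
rewrite differential_reduction //.
case: z X XP => [[[g mu] xi] nu] _ _ /=.
rewrite linear_split; last exact: differential_linear.
(* The explicit vector of [E] has no component along [mu], and its [xi] component, which carries the
   derivative of [E] in [mu], is dropped by the projection. Hence the bracket contains no derivative
   in [mu]. *)
have -> : differential (reduced_atlas A) F (g, mu, nu) (0, 0, 0) = 0.
  have := @differential_linear _ _ (reduced_atlas A) F (g, mu, nu) (-1) 0 0.
  by rewrite scaler0 addr0 scaleN1r addNr.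
rewrite -(partial_nu_pairing g mu nu _ Fs).
rewrite covector_pairing (pairing_TRdual g mu nu (partial_nu F g mu nu) Es).
rewrite (pairing_TRdual g mu nu (partial_nu E g mu nu) Fs).
move: (differential _ _ _ _) (differential _ _ _ _) (pairing _ _) => p q r.
ring.
Qed.

(** * Smoothness of the action and of the quotient *)

Lemma translation_smooth : smooth_map (prod_atlas (TTG_atlas A) (vatlas lie))
  (TTG_atlas A) (fun p => @translation R n G p.1 p.2).
Proof.
have tE : (fun p : TTG * lie => translation p.1 p.2) =
    (fun p => (p.1.1.1.1, p.1.1.1.2, p.1.1.2 + p.2, p.1.2)).
  by apply/funext => -[[[[g mu] xi] nu] eta].
split.
  rewrite tE.
  have c1 : continuous (fun p : TTG * lie => p.1.1.2) by continuous_proj.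
  have c2 : continuous (fun p : TTG * lie => p.2) by continuous_proj.
  have c : continuous (fun p : TTG * lie => p.1.1.2 + p.2).
    by move=> p; exact: cvgD (c1 p) (c2 p).
  apply: continuous_pair_fun; last by continuous_proj.
  by apply: continuous_pair_fun; [continuous_proj|exact: c].
move=> [[[[g0 mu0] xi0] nu0] eta0] [[[g1 mu1] xi1] nu1] k.
set f := (X in Ck k _ X).
have {f}-> : f = (fun v : TTG_model * lie =>
    (chart A g1 (ichart A g0 v.1.1.1.1), v.1.1.1.2, v.1.1.2 + v.2, v.1.2)) by [].
pose C := chart A g0 @` (cdom A g0 `&` cdom A g1).
pose L (v : TTG_model * lie) := v.1.1.1.1.
have Ld v : is_diff v L L by rewrite /L; is_diff_proj.
have oC : open C by apply: open_chart_image => //; exact: cdom_open.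
have oU : open (L @^-1` C) by exact: open_affine_preimage Ld oC.
(* The domain is enlarged to an open set that constrains the [G] coordinate alone. There the [G]
   component is a chart transition and the other components are affine. *)
apply: (@Ck_subset _ _ _ _ (L @^-1` C)).
  move=> _ [[[[[g mu] xi] nu] eta] [[[[[/= g0g _] _] _] _] [[[/= g1g _] _] _]] <-].
  by exists g.
have aff (W : normedModType R) (h dh : TTG_model * lie -> W) :
    (forall x, is_diff x h dh) -> Ck k (L @^-1` C) h.
  exact: Ck_affine.
apply: Ck_pair => //; last by apply: aff => x; is_diff_proj.
apply: Ck_pair => //.
  apply: Ck_pair => //; last by apply: aff => x; is_diff_proj.
  exact: (Ck_comp_affine oU Ld (fun x => id) (transition_smooth hA g0 g1 k)).
apply: aff => x; apply: is_diffD; first by apply: is_diff_snd; is_diff_proj.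
by is_diff_proj.
Qed.

Lemma reduction_map_smooth : smooth_map (TTG_atlas A) (reduced_atlas A)
  (@reduction_map R n G).
Proof.
have rE : @reduction_map R n G = (fun z : TTG => (z.1.1.1, z.1.1.2, z.2)).
  by apply/funext => -[[[g mu] xi] nu].
split; first by rewrite rE; continuous_proj.
move=> [[[g0 mu0] xi0] nu0] [[g1 mu1] nu1] k.
set f := (X in Ck k _ X).
have {f}-> : f = (fun v : TTG_model =>
    (chart A g1 (ichart A g0 v.1.1.1), v.1.1.2, v.2)) by [].
pose C := chart A g0 @` (cdom A g0 `&` cdom A g1).
pose L (v : TTG_model) := v.1.1.1.
have Ld v : is_diff v L L by rewrite /L; is_diff_proj.
have oC : open C by apply: open_chart_image => //; exact: cdom_open.
have oU : open (L @^-1` C) by exact: open_affine_preimage Ld oC.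
apply: (@Ck_subset _ _ _ _ (L @^-1` C)).
  move=> _ [[[[g mu] xi] nu] [[[[/= g0g _] _] _] [[/= g1g _] _]] <-].
  by exists g.
apply: Ck_pair => //; last by apply: Ck_affine => x; is_diff_proj.
apply: Ck_pair => //; last by apply: Ck_affine => x; is_diff_proj.
exact: (Ck_comp_affine oU Ld (fun x => id) (transition_smooth hA g0 g1 k)).
Qed.

(** The section [xi = 0] of the projection recovers [E] from its pullback. Projection and section
    are both affine in charts, so the C^k property passes in both directions by composition. *)
Lemma reduction_map_quotient (E : Red -> R^o) :
  smooth_fun (reduced_atlas A) E
  <-> smooth_fun (TTG_atlas A) (fun z => E (reduction_map z)).
Proof.
split=> -[Ec Es]; split.
- move=> z; apply: continuous_comp; [exact: reduction_map_smooth.1|exact: Ec].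
- move=> [[[g0 mu0] xi0] nu0] q k.
  pose L (v : TTG_model) : Red_model := (v.1.1.1, v.1.1.2, v.2).
  pose L1 (v : TTG_model) : lie := v.1.1.1.
  have L1d v : is_diff v L1 L1 by rewrite /L1; is_diff_proj.
  have Ld v : is_diff v L L by rewrite /L; is_diff_proj.
  have oU : open (L1 @^-1` (chart A g0 @` cdom A g0)).
    by apply: open_affine_preimage L1d _; exact: codom_open.
  have sU : chart (TTG_atlas A) (g0, mu0, xi0, nu0) @` (cdom (TTG_atlas A) (g0, mu0, xi0, nu0)
      `&` (fun z => E (reduction_map z)) @^-1` cdom (vatlas R^o) q)
      `<=` L1 @^-1` (chart A g0 @` cdom A g0).
    by move=> _ [[[[g mu] xi] nu] [[[[/= g0g _] _] _] _] <-]; exists g.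
  apply: (Ck_subset sU); apply: (Ck_comp_affine oU Ld _ (Es (g0, mu0, nu0) q k)).
  by move=> [[[v1 v2] v3] v4] /= [g g0g gE]; exists (g, v2, v4); [|rewrite /L /= -[v1]gE].
- have sc : continuous (fun s : Red => (s.1.1, s.1.2, 0, s.2) : TTG) by continuous_proj.
  have -> : E = (fun z => E (reduction_map z)) \o (fun s : Red => (s.1.1, s.1.2, 0, s.2)).
    by apply/funext => -[[g mu] nu].
  by move=> s; apply: continuous_comp; [exact: sc|exact: Ec].
- move=> [[g0 mu0] nu0] q k.
  pose L (v : Red_model) : TTG_model := (v.1.1, v.1.2, 0, v.2).
  pose L1 (v : Red_model) : lie := v.1.1.
  have L1d v : is_diff v L1 L1 by rewrite /L1; is_diff_proj.
  have Ld v : is_diff v L L by rewrite /L; is_diff_proj.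
  have oU : open (L1 @^-1` (chart A g0 @` cdom A g0)).
    by apply: open_affine_preimage L1d _; exact: codom_open.
  have sU : chart (reduced_atlas A) (g0, mu0, nu0) @` (cdom (reduced_atlas A) (g0, mu0, nu0)
      `&` E @^-1` cdom (vatlas R^o) q)
      `<=` L1 @^-1` (chart A g0 @` cdom A g0).
    by move=> _ [[[g mu] nu] [[[/= g0g _] _] _] <-]; exists g.
  apply: (Ck_subset sU); apply: (Ck_comp_affine oU Ld _ (Es (g0, mu0, 0, nu0) q k)).
  by move=> [[v1 v2] v3] /= [g g0g gE]; exists (g, v2, 0, v3); [|rewrite /L /= -[v1]gE].
Qed.

(** The form is invariant under translation in [xi]. Once the differentials are identified, both
    Hamiltonian vectors are the same choice from the same set. *)
Lemma poisson_bracket_translation a (E F : TTG -> R^o) z :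
    smooth_fun (TTG_atlas A) E -> smooth_fun (TTG_atlas A) F ->
  poisson_bracket A (fun y => E (translation y a)) (fun y => F (translation y a)) z
  = poisson_bracket A E F (translation z a).
Proof.
move=> Es Fs; rewrite /poisson_bracket /hamiltonian_vector.
rewrite !differential_translation //.
by case: z => [[[g mu] xi] nu].
Qed.

End Reduction.

Theorem proposition6p6 (R : realType) (n : nat) (G : groupTopType)
    (A : atlas G 'rV[R]_n) (hG : lie_group A) :
  poisson_reduction (TTG_atlas A) (reduced_atlas A)
    (@translation R n G) (poisson_bracket A)
    (@reduction_map R n G) (reduced_bracket A).
Proof.
split.
- by move=> [[[g mu] xi] nu] /=; rewrite addr0.
- by move=> [[[g mu] xi] nu] a b /=; rewrite addrA.
- exact: translation_smooth.
- by move=> a E F Es Fs z; exact: poisson_bracket_translation.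
- by move=> [[g mu] nu]; exists (g, mu, 0, nu).
- move=> [[[g mu] xi] nu] [[[g' mu'] xi'] nu'] /=; split=> [[<- <- <-]|[a [-> -> _ ->]] //].
  by exists (xi' - xi); rewrite addrC subrK.
- exact: reduction_map_smooth.
- exact: reduction_map_quotient.
- by move=> E F Es Fs z; exact: poisson_bracket_reduction.
Qed.
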